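(* Let $a>0$, $u\ge0$, let $(U_k)_{k\ge1}$ be i.i.d. positive random variables with distribution function $F(x)=\mathbf{P}\{U_1<x\}$, and let $(V_k)_{k\ge1}$ be i.i.d. random variables, independent of $(U_k)$, with distribution function $G(x)=\mathbf{P}\{V_1<x\}=\mathbf{1}_{(a,\infty)}(x)$ (so $V_k=a$ almost surely). Put $X_k=\max\{U_1,\dots,U_k\}$, $Y_k=\max\{V_1,\dots,V_k\}$ and $$\delta(u)=\mathbf{P}\bigl\{\max\{u,Y_k\}>X_k\ \text{ for all } k\in\mathbb{N},\ k\ge1\bigr\}.$$ Then $$\delta(u)=\lim_{k\to\infty}F\bigl(\max\{u,a\}\bigr)^k .$$ In particular, if $F(x)<1$ for all $x>0$ then $\delta(u)=0$, whereas if $U_1\le c$ almost surely for some constant $c<\max\{u,a\}$ then $\delta(u)=1$.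
   Context: This is the non-ruin probability in the infinite time horizon for the risk model based on the $\infty$-convolution (max-convolution) $\delta_x\diamond\delta_y=\delta_{\max\{x,y\}}$, where the cumulated claims are $X_k$, the cumulated incomes started from the initial capital $u$ are $\max\{u,Y_k\}$, and the premium distribution is the one with the lack of memory property for this convolution. *)

(* Defs.v *)
From HB Require Import structures.
From mathcomp Require Import all_boot all_order all_algebra.
From mathcomp Require Import all_classical all_reals all_analysis.

Set Implicit Arguments.
Unset Strict Implicit.
Unset Printing Implicit Defensive.

Import Order.TTheory GRing.Theory Num.Theory.
Import numFieldNormedType.Exports.

Local Open Scope classical_set_scope.
Local Open Scope ring_scope.

(** A sequence [Z_1, Z_2, ...] is represented by [Z : nat -> _] with [Z i]
    standing for Z_{i+1}. *)

Section random_sequences.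
Context {d : measure_display} {T : measurableType d} {R : realType}.
Variable P : probability T R.
Implicit Types Z U V : nat -> {RV P >-> R}.

Definition mutually_independent Z : Prop :=
  forall (s : seq nat) (B : nat -> set R), uniq s ->
    (forall i, measurable (B i)) ->
    P (\bigcap_(i in [set` s]) (Z i @^-1` B i)) =
    (\prod_(i <- s) P (Z i @^-1` B i))%E.

Definition identically_distributed Z : Prop :=
  forall (i j : nat) (B : set R), measurable B ->
    distribution P (Z i) B = distribution P (Z j) B.

Definition iid Z : Prop := mutually_independent Z /\ identically_distributed Z.

(** The sigma-algebra sigma(Z_1, Z_2, ...). *)
Definition sigma_of Z : set (set T) :=
  <<s [set A | exists i (B : set R), measurable B /\ A = Z i @^-1` B] >>.

Definition independent_sequences U V : Prop :=
  forall A B : set T, sigma_of U A -> sigma_of V B ->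
    P (A `&` B) = (P A * P B)%E.

(** max{Z_1, ..., Z_k}, meaningful for [1 <= k]; the default value [Z 0 w] of
    the iterated maximum is then one of the terms, hence harmless. *)
Definition running_max Z (k : nat) (w : T) : R :=
  \big[Num.max/Z 0%N w]_(i < k) Z i w.

(** The infinite-horizon non-ruin probability delta(u). *)
Definition nonruin_probability U V (u : R) : \bar R :=
  P [set w | forall k : nat, (1 <= k)%N ->
               Num.max u (running_max V k w) > running_max U k w].

End random_sequences.

(* Main.v *)
Require Import Defs.
From HB Require Import structures.
From mathcomp Require Import all_boot all_order all_algebra.
From mathcomp Require Import all_classical all_reals all_analysis.
From mathcomp Require Import measurable_realfun.
Import Order.TTheory GRing.Theory Num.Theory.
Import numFieldNormedType.Exports.
Local Open Scope classical_set_scope.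
Local Open Scope ring_scope.

(** As every [V i] is almost surely equal to [a], non-ruin means, up to a null
    set, that every [U i] is below [max u a].  This event is the decreasing intersection over [k] of the events
    that the first [k] claims are below [max u a], which have probability
    [F (max u a) ^+ k] by independence; continuity from above gives the limit. *)

Section ae_facts.
Context {d : measure_display} {T : measurableType d} {R : realType}.

Lemma ae_notin_null (mu : {measure set T -> \bar R}) (A : set T) :
  measurable A -> mu A = 0%E -> {ae mu, forall w, ~ A w}.
Proof.
by move=> mA muA0; exists A; split => // w /contrapT.
Qed.

Lemma ae_in_full (P : probability T R) (A : set T) :
  measurable A -> P A = 1%E -> {ae P, forall w, A w}.
Proof.
move=> mA PA1; have : {ae P, forall w, ~ (~` A) w}.
  apply: ae_notin_null; first exact: measurableC.
  by apply: etrans (probability_setC P mA) _; rewrite PA1 subee.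
by apply: filterS => w /contrapT.
Qed.

(** The points of [A] outside [B] lie in a measurable null set [N], so [A] is included in the union
    of [B] and [N], which has the measure of [B]. *)
Lemma ae_le_measure (mu : {measure set T -> \bar R}) (A B : set T) :
  measurable A -> measurable B -> {ae mu, forall w, A w -> B w} ->
  (mu A <= mu B)%E.
Proof.
move=> mA mB [N [mN muN0 notABN]].
rewrite -(measureU0 mB mN muN0).
apply: le_measure; rewrite ?inE//; first exact: measurableU.
move=> w Aw; have [Bw|nBw] := pselect (B w); [by left|right].
by apply: notABN => /(_ Aw).
Qed.

Lemma ae_eq_measure (mu : {measure set T -> \bar R}) (A B : set T) :
  measurable A -> measurable B -> {ae mu, forall w, A w <-> B w} ->
  mu A = mu B.
Proof.
move=> mA mB AB; apply/eqP; rewrite eq_le.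
by apply/andP; split; apply: ae_le_measure => //;
  apply: filterS AB => w [].
Qed.

End ae_facts.

Section running_maximum.
Context {d : measure_display} {T : measurableType d} {R : realType}.
Variable P : probability T R.
Implicit Types Z U V : nat -> {RV P >-> R}.

Lemma measurable_lt_RV (X : {RV P >-> R}) (x : R) :
  measurable [set w | X w < x].
Proof.
rewrite [X in measurable X](_ : _ = X @^-1` `]-oo, x[%classic).
  exact: measurable_funPTI.
by apply/seteqP; split=> w /=; rewrite in_itv.
Qed.

Lemma measurable_running_max Z k : measurable_fun setT (running_max Z k).
Proof.
(* Passing from ordinals to a list of indices allows induction on an arbitrary list, with the
   default [Z 0] as base case. *)
rewrite /running_max; under eq_fun do rewrite -(big_mkord xpredT (fun i => Z i _)).
elim: (index_iota 0 k) => [|i s IHs].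
  by under eq_fun do rewrite big_nil; exact: measurable_funPT.
by under eq_fun do rewrite big_cons; exact: measurable_maxr.
Qed.

Lemma running_max_ltP Z k w (m : R) : (0 < k)%N ->
  running_max Z k w < m <-> forall i, (i < k)%N -> Z i w < m.
Proof.
move=> k_gt0; split.
  by move=> /bigmax_ltP[_ Zm] i ik; exact: (Zm (Ordinal ik)).
(* The default [Z 0 w] must be bounded too; since [0 < k], it is one of the terms. *)
by move=> Zm; apply: bigmax_lt => [|i _]; apply: Zm.
Qed.

Lemma running_max_const Z k w (c : R) :
  (forall i, Z i w = c) -> running_max Z k w = c.
Proof.
move=> Zc; rewrite /running_max Zc.
elim/big_ind: _ => // x y -> ->; exact: maxxx.
Qed.

Lemma iid_measure_preimage Z (i : nat) (B : set R) : iid Z -> measurable B ->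
  P (Z i @^-1` B) = P (Z 0%N @^-1` B).
Proof. by move=> [_ Zid] mB; exact: (Zid i 0%N B mB). Qed.

Lemma iid_cdf Z (F : R -> R) : iid Z ->
  (forall x, P [set w | Z 0%N w < x] = (F x)%:E) ->
  forall i x, P [set w | Z i w < x] = (F x)%:E.
Proof.
move=> Ziid ZF i x; rewrite -ZF.
have ltE j : [set w | Z j w < x] = Z j @^-1` `]-oo, x[%classic.
  by apply/seteqP; split=> w /=; rewrite in_itv.
by rewrite !ltE iid_measure_preimage.
Qed.

Lemma iid_cdf_prefix Z (F : R -> R) (x : R) (k : nat) : iid Z ->
  (forall x, P [set w | Z 0%N w < x] = (F x)%:E) ->
  P [set w | forall i, (i < k)%N -> Z i w < x] = (F x ^+ k)%:E.
Proof.
move=> Ziid ZF.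
have ltE i : Z i @^-1` `]-oo, x[%classic = [set w | Z i w < x].
  by apply/seteqP; split=> w /=; rewrite in_itv.
rewrite [X in P X](_ : _ =
    \bigcap_(i in [set` iota 0 k]) (Z i @^-1` `]-oo, x[%classic)); last first.
  apply/seteqP; split=> w /= Zw i.
    by rewrite /= mem_iota => /andP[_ ik]; rewrite in_itv/=; exact: Zw.
  by move=> ik; have := Zw i; rewrite /= mem_iota in_itv/=; exact.
have [indep _] := Ziid.
(* Independence is applied to the first [k] indices with the same half-line for each, which gives
   [k] equal factors [F x]. *)
rewrite (indep _ (fun=> `]-oo, x[%classic)) ?iota_uniq//.
under eq_bigr do rewrite ltE (iid_cdf _ _ Ziid ZF).
by rewrite prodEFin big_const_seq count_predT size_iota -Monoid.iteropE.
Qed.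

Lemma cvg_iid_cdf Z (F : R -> R) (x : R) : iid Z ->
  (forall x, P [set w | Z 0%N w < x] = (F x)%:E) ->
  (F x ^+ k)%:E @[k --> \oo] --> P [set w | forall i, Z i w < x].
Proof.
move=> Ziid ZF.
pose B k := [set w | forall i, (i < k)%N -> Z i w < x].
have mB k : measurable (B k).
  rewrite (_ : B k = \bigcap_(i in [set i | (i < k)%N]) [set w | Z i w < x]).
    by apply: bigcap_measurableType => i _; exact: measurable_lt_RV.
  by apply/seteqP; split=> w Bw i; exact: Bw.
rewrite (_ : [set w | _] = \bigcap_k B k); last first.
  (* [B k] only constrains indices below [k], so the bound on [Z i] is read off [B i.+1]. *)
  by apply/seteqP; split=> [w Zw k _ i _|w Bw i]; [exact: Zw|exact: (Bw i.+1)].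
under eq_fun do rewrite -(iid_cdf_prefix _ _ x _ Ziid ZF).
apply: nonincreasing_cvg_mu => //.
(* Continuity from above starts from a set of finite measure, here [B 0]. *)
- exact: le_lt_trans (probability_le1 _ _) (ltry _).
- by apply: bigcap_measurableType => k _; exact: mB.
- move=> m n mn; apply/subsetPset => w Bw i im; apply: Bw.
  exact: leq_trans im mn.
Qed.

(** The distribution function is 0 at [a] itself, the interval being open there, so almost surely
    [Z i] is at least [a]. It is 1 at each [a + 1/(n+1)], and countably many almost sure bounds hold
    simultaneously, which leaves only the value [a]. *)
Lemma iid_degenerate_ae Z (a : R) : iid Z ->
  (forall x : R, P [set w | Z 0%N w < x] = (\1_(`]a, +oo[%classic) x)%:E) ->
  {ae P, forall w, forall i, Z i w = a}.
Proof.
move=> Ziid Zdf; apply: ae_foralln => i.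
have Zle : {ae P, forall w, ~ (Z i w < a)}.
  apply: ae_notin_null; first exact: measurable_lt_RV.
  apply: etrans (iid_cdf _ _ Ziid Zdf i a) _.
  by rewrite indicE memNset//= in_itv/= ltxx.
have Zge : {ae P, forall w, forall n : nat, Z i w < a + n.+1%:R^-1}.
  apply: ae_foralln => n; apply: ae_in_full; first exact: measurable_lt_RV.
  by rewrite (iid_cdf _ _ Ziid Zdf) indicE mem_set//= in_itv/= ltrDl invr_gt0 ltr0Sn.
apply: filterS2 Zle Zge => w /negP; rewrite -leNgt => aZ Za.
apply/eqP; rewrite eq_le aZ andbT.
apply/ler_addgt0Pl => e e0.
have [n _ /(_ n (leqnn _)) ne] := near_infty_natSinv_lt (PosNum e0).
by apply/ltW/(lt_trans (Za n)); rewrite addrC ltrD2r.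
Qed.

Lemma nonruin_probability_degenerate U V (a u : R) :
  {ae P, forall w, forall i, V i w = a} ->
  nonruin_probability U V u = P [set w | forall i, U i w < Num.max u a].
Proof.
move=> Va; apply: ae_eq_measure.
- rewrite [X in measurable X](_ : _ = \bigcap_(k in [set k | (1 <= k)%N])
      [set w | running_max U k w < Num.max u (running_max V k w)]); last first.
    by apply/seteqP; split=> w Bw i; exact: Bw.
  apply: bigcap_measurableType => k _.
  rewrite -[X in measurable X]setTI.
  (* The event is the preimage of [true] under the boolean comparison of two measurable
     functions. *)
  apply: (measurable_fun_ltr _ _ measurableT (Y := [set true])) => //.
  + exact: measurable_running_max.
  + by apply: measurable_maxr => //; exact: measurable_running_max.
- rewrite [X in measurable X](_ : _ =
      \bigcap_i [set w | U i w < Num.max u a]); last first.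
    by apply/seteqP; split=> [w Bw i _|w Bw i]; exact: Bw.
  by apply: bigcap_measurableType => i _; exact: measurable_lt_RV.
- apply: filterS Va => w Va /=; split=> [Uw i|Uw k k0].
    (* The term [U i] is among the first [i.+1], and this horizon is at least 1. *)
    have := Uw i.+1 isT; rewrite (running_max_const _ _ _ _ Va).
    by move=> /running_max_ltP; exact.
  by rewrite (running_max_const _ _ _ _ Va); apply/running_max_ltP.
Qed.

End running_maximum.

Theorem mainTheorem2 (R : realType) (d : measure_display)
    (T : measurableType d) (P : probability T R)
    (U V : nat -> {RV P >-> R}) (F G : R -> R) (a u : R)
    (a_gt0 : 0 < a) (u_ge0 : 0 <= u)
    (U_iid : iid U)
    (U_pos : forall k : nat, {ae P, forall w, 0 < U k w})
    (U_df : forall x : R, P [set w | U 0%N w < x] = (F x)%:E)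
    (V_iid : iid V)
    (V_df : forall x : R, P [set w | V 0%N w < x] = (G x)%:E)
    (G_def : forall x : R, G x = \1_(`]a, +oo[%classic) x)
    (UV_indep : independent_sequences U V) :
  [/\ (F (Num.max u a) ^+ k)%:E @[k --> \oo] --> nonruin_probability U V u,
      (forall x : R, 0 < x -> F x < 1) -> nonruin_probability U V u = 0%E
    & (exists2 c : R, c < Num.max u a & {ae P, forall w, U 0%N w <= c}) ->
        nonruin_probability U V u = 1%E].
Proof.
have Va : {ae P, forall w, forall i, V i w = a}.
  by apply: iid_degenerate_ae => // x; rewrite V_df G_def.
rewrite (nonruin_probability_degenerate _ _ _ _ _ Va).
set m := Num.max u a.
have Fcvg := cvg_iid_cdf _ _ _ m U_iid U_df.
split => //.
- have m_gt0 : 0 < m by rewrite lt_max a_gt0 orbT.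
  move=> /(_ m m_gt0) Fm1; apply: (cvg_unique _ Fcvg) => //.
  apply: cvg_EFin; first exact: nearW.
  (* Powers tend to 0 when the base has absolute value below 1; [F m] is nonnegative because it is a
     probability. *)
  apply: cvg_expr; rewrite ger0_norm// -lee_fin -U_df.
  exact: measure_ge0.
- move=> [c cm Uc].
  (* The gap [c < m] turns the almost sure bound [U 0 <= c] into the strict one defining [F m]; the
     powers of [F m] are then constantly 1. *)
  have Fm1 : F m = 1.
    apply: EFin_inj; rewrite -U_df -(@probability_setT _ _ _ P).
    apply: ae_eq_measure => //; first exact: measurable_lt_RV.
    by apply: filterS Uc => w Uw; split=> // _; exact: le_lt_trans cm.
  apply: (cvg_unique _ Fcvg) => //.
  by apply: cvg_near_cst; apply: nearW => k; rewrite Fm1 expr1n.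
Qed.
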